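(* Consider the family of systems, indexed by $(y,z)$ with $y,z\ge0$ and $y+z\le1$, in which exactly $1$ packet arrives every slot (so $\lambda=1$) and the channel states $\omega(t)\in\{1,2,3\}$ are i.i.d. over slots with $\Pr[\omega(t)=3]=y$, $\Pr[\omega(t)=2]=z$, $\Pr[\omega(t)=1]=1-y-z$. There is a universal constant $c>0$ such that for every $\epsilon$ with $0<\epsilon<1/64$ and every control algorithm (without knowledge of $y$ and $z$), there is a choice of $(y,z)$ for which the following holds: if $t\ge 1$ is a slot at which the algorithm produces an $\epsilon$-approximation, i.e. $$\overline{p}(t)\le p^*+\epsilon\qquad\text{and}\qquad 1-\overline{\mu}(t)\le\epsilon ,$$ then $t\ge c/\epsilon$. That is, the convergence time is at least $\Omega(1/\epsilon)$ under any algorithm.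
   Context: Time is slotted, $t\in\{0,1,2,\dots\}$. Each slot the controller observes $\omega(t)$ and chooses power $p(t)\in\{0,1\}$; the service offered is $\mu(t)=p(t)\omega(t)$. The arrivals are $a(t)=1$ for all $t$. The history at slot $t>0$ is $\mathcal{H}(t)=\{(a(0),\omega(0),p(0)),\dots,(a(t-1),\omega(t-1),p(t-1))\}$, and $\mathcal{H}(0)=0$ (trivial). A control algorithm is a specification, for every slot $t$ and $i\in\{1,2,3\}$, of conditional probabilities $\theta_i(t)=\Pr[p(t)=1\mid\omega(t)=i,a(t),\mathcal{H}(t)]$, as functions of the history that do not depend on the unknown parameters $(y,z)$; $\omega(t)$ is independent of $\mathcal{H}(t)$. For a process $b(\tau)$ and $t>0$, $\overline{b}(t)=\frac1t\sum_{\tau=0}^{t-1}\mathbb{E}[b(\tau)]$; this defines $\overline{\mu}(t)$ and $\overline{p}(t)$. $p^*$ (depending on $(y,z)$) is the minimum average power required to support the rate $\lambda=1$, namely $p^*=h(1)$, where $h$ gives the minimum of $\mathbb{E}[p(t)]$ on one slot subject to $\mathbb{E}[\mu(t)]=\mu$: $$h(\mu)=\begin{cases}\mu/3 & 0\le\mu\le3y,\\ y+(\mu-3y)/2 & 3y\le\mu\le3y+2z,\\ \mu-2y-z & 3y+2z\le\mu\le2y+z+1.\end{cases}$$ *)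

(* Defs.v *)
From HB Require Import structures.
From mathcomp Require Import all_boot all_order all_algebra.
From mathcomp Require Import all_classical all_reals all_analysis.
From mathcomp Require Import ring lra.

Set Implicit Arguments.
Unset Strict Implicit.
Unset Printing Implicit Defensive.

Import Order.TTheory GRing.Theory Num.Theory.
Local Open Scope classical_set_scope.
Local Open Scope ring_scope.

(* One past slot as recorded in the history: (a, omega, p), the power p in
   {0, 1} being a boolean. *)
Definition slot_record : Type := (nat * nat * bool)%type.

(* [theta t i a h] is Pr[p(t) = 1 | omega(t) = i, a(t) = a, H(t) = h].  Only the
   values at i in {1, 2, 3} and at histories h of length t matter.  The system
   parameters (y, z) are not an argument. *)
Record control_algorithm (R : realType) := ControlAlgorithm {
  theta :> nat -> nat -> nat -> seq slot_record -> R;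
  theta_ge0 : forall t i a h, 0 <= theta t i a h;
  theta_le1 : forall t i a h, theta t i a h <= 1
}.

Section system.
Context (d : measure_display) (T : measurableType d) (R : realType).
Variable P : probability T R.

Definition Pr (A : set T) : R := fine (P A).

(* Junk value 0 when Pr B = 0. *)
Definition condPr (A B : set T) : R := Pr (A `&` B) / Pr B.

(* Mutual independence of discrete random variables: every subset of nat is
   measurable. *)
Definition mutually_independent (X : nat -> {RV P >-> nat}) : Prop :=
  forall (J : seq nat) (A : nat -> set nat), uniq J ->
    Pr (\bigcap_(t in [set` J]) X t @^-1` A t) =
    \prod_(t <- J) Pr (X t @^-1` A t).

Variables (a omega : nat -> {RV P >-> nat}) (p : nat -> {RV P >-> bool}).

(* The history H(t), listed in chronological order; H(0) is the empty list. *)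
Definition history (t : nat) (w : T) : seq slot_record :=
  [seq (a s w, omega s w, p s w) | s <- iota 0 t].

(* The service mu(t) = p(t) omega(t). *)
Definition service (t : nat) (w : T) : R := (p t w * omega t w)%:R.

Definition power (t : nat) (w : T) : R := (p t w)%:R.

(* (1/t) \sum_(s < t) E[b(s)], for t > 0. *)
Definition time_average (b : nat -> T -> R) (t : nat) : \bar R :=
  ((t%:R^-1)%:E * \sum_(0 <= s < t) 'E_P[b s])%E.

Record runs_algorithm (alg : control_algorithm R) (y z : R) : Prop := {
  arrival_one : forall t w, a t w = 1%N;
  omega_range : forall t w, omega t w \in [:: 1; 2; 3]%N;
  omega_law3 : forall t, Pr (omega t @^-1` [set 3%N]) = y;
  omega_law2 : forall t, Pr (omega t @^-1` [set 2%N]) = z;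
  omega_law1 : forall t, Pr (omega t @^-1` [set 1%N]) = 1 - y - z;
  omega_indep : mutually_independent omega;
  omega_indep_history : forall t (A : set nat) (B : set (seq slot_record)),
    Pr (omega t @^-1` A `&` history t @^-1` B) =
    Pr (omega t @^-1` A) * Pr (history t @^-1` B);
  power_law : forall t i n h,
    let obs := omega t @^-1` [set i] `&` a t @^-1` [set n]
               `&` history t @^-1` [set h] in
    Pr obs != 0 ->
    condPr (p t @^-1` [set true]) obs = alg t i n h
}.

End system.

(* The minimum of E[p(t)] on one slot subject to E[mu(t)] = mu, meaningful for
   0 <= mu <= 2y + z + 1; see [min_powerP]. *)
Definition min_power (R : realType) (y z mu : R) : R :=
  if mu <= 3 * y then mu / 3
  else if mu <= 3 * y + 2 * z then y + (mu - 3 * y) / 2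
  else mu - 2 * y - z.

Definition pstar (R : realType) (y z : R) : R := min_power y z 1.

(* Here q1, q2, q3 are the probabilities of transmitting in the channel states
   1, 2, 3. *)
Definition one_slot_power (R : realType) (y z q1 q2 q3 : R) : R :=
  (1 - y - z) * q1 + z * q2 + y * q3.

Definition one_slot_service (R : realType) (y z q1 q2 q3 : R) : R :=
  (1 - y - z) * q1 + 2 * z * q2 + 3 * y * q3.

Lemma min_powerP (R : realType) (y z mu : R) :
  0 <= y -> 0 <= z -> y + z <= 1 -> 0 <= mu -> mu <= 2 * y + z + 1 ->
  (exists q1 q2 q3 : R,
    [/\ 0 <= q1 <= 1, 0 <= q2 <= 1, 0 <= q3 <= 1,
        one_slot_service y z q1 q2 q3 = mu
      & one_slot_power y z q1 q2 q3 = min_power y z mu]) /\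
  (forall q1 q2 q3 : R, 0 <= q1 <= 1 -> 0 <= q2 <= 1 -> 0 <= q3 <= 1 ->
    one_slot_service y z q1 q2 q3 = mu ->
    min_power y z mu <= one_slot_power y z q1 q2 q3).
Proof.
have frac (x b : R) : 0 <= x -> x <= b -> exists2 q, 0 <= q <= 1 & b * q = x.
  move=> x0 xb; have [b0|b0] := eqVneq b 0.
    by exists 0; [rewrite lexx ler01 | rewrite mulr0; lra].
  have bgt0 : 0 < b by rewrite lt_neqAle eq_sym b0 (le_trans x0).
  exists (x / b); last by rewrite mulrC divfK.
  by rewrite divr_ge0 ?(ltW bgt0) //= ler_pdivrMr // mul1r.
rewrite /one_slot_service /one_slot_power /min_power.
move=> y0 z0 yz mu0 mu1; split; last first.
  move=> q1 q2 q3 /andP[? ?] /andP[? ?] /andP[? ?] <-.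
  have ? : 0 <= (1 - y - z) * q1 by apply: mulr_ge0 => //; lra.
  have ? : 0 <= (1 - y - z) * (1 - q1) by apply: mulr_ge0; lra.
  have ? : 0 <= z * q2 by apply: mulr_ge0.
  have ? : 0 <= z * (1 - q2) by apply: mulr_ge0; lra.
  have ? : 0 <= y * q3 by apply: mulr_ge0.
  have ? : 0 <= y * (1 - q3) by apply: mulr_ge0; lra.
  by case: ifP => _; [|case: ifP => _]; lra.
case: ifPn => [h3|]; [|rewrite -ltNge => h3; case: ifPn => [h2|]].
- have [q qI qE] := frac _ _ mu0 h3.
  by exists 0, 0, q; rewrite !lexx !ler01; split=> //; lra.
- have [||q qI qE] := frac (mu - 3 * y) (2 * z); [lra|lra|].
  by exists 0, q, 1; rewrite !lexx !ler01; split=> //; lra.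
- rewrite -ltNge => h2.
  have [||q qI qE] := frac (mu - 3 * y - 2 * z) (1 - y - z); [lra|lra|].
  by exists q, 1, 1; rewrite !lexx !ler01; split=> //; lra.
Qed.

(* Main.v *)
Require Import Defs.
From HB Require Import structures.
From mathcomp Require Import all_boot all_order all_algebra.
From mathcomp Require Import all_classical all_reals all_analysis.
From mathcomp Require Import measurable_realfun lra.

Set Implicit Arguments.
Unset Strict Implicit.
Unset Printing Implicit Defensive.

Import Order.TTheory GRing.Theory Num.Theory.
Local Open Scope ring_scope.

(** The history at slot 0 is trivial, so the algorithm must fix the probability
   [theta_2(0)] of transmitting in state 2 before learning anything about (y, z).
   If it is at least 1/2, take y = z = 1/2, for which transmitting in state 2 is
   wasteful; otherwise take y = 0 and z = 1/2, for which not transmitting in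
   state 2 is wasteful.  In every slot E[p] lies above a line supporting the convex
   function h at 1, evaluated at E[mu]; in slot 0 it does so with a constant slack
   kappa.  Averaging over t slots leaves a slack of kappa / t, which an
   epsilon-approximation bounds by (1 + slope) * epsilon. *)

Section transmission.
Context (d : measure_display) (T : measurableType d) (R : realType).
Variable P : probability T R.

(** A joint rather than a conditional probability: the expected power and service are linear in it,
    and it stays meaningful when state [i] has probability 0. *)
Definition transmit_prob (p : T -> bool) (omega : T -> nat) (i : nat) : R :=
  Pr P ((p @^-1` [set true]) `&` (omega @^-1` [set i]))%classic.

Variables (p : {RV P >-> bool}) (omega : {RV P >-> nat}).

Lemma measurable_transmit i :
  measurable ((p @^-1` [set true]) `&` (omega @^-1` [set i]))%classic.
Proof. by apply: measurableI; apply: measurable_funPTI. Qed.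

Lemma transmit_prob_ge0 i : 0 <= transmit_prob p omega i.
Proof. exact/fine_ge0/measure_ge0. Qed.

Lemma transmit_prob_le i :
  transmit_prob p omega i <= Pr P (omega @^-1` [set i])%classic.
Proof.
have mo : measurable (omega @^-1` [set i])%classic by apply: measurable_funPTI.
have mt := measurable_transmit i.
apply: fine_le; [exact: fin_num_measure|exact: fin_num_measure|].
by apply: le_measure; rewrite ?inE //; apply: subIsetr.
Qed.

(** The integrand is a combination of indicators of the disjoint events defining [transmit_prob].
    Taking [f] constant 1 gives the power, and [f = id] the service. *)
Lemma expectation_transmit (f : nat -> nat) :
  (forall w, omega w \in [:: 1; 2; 3]%N) ->
  'E_P[fun w => (p w * f (omega w))%:R : R]%E =
  (\sum_(i <- [:: 1; 2; 3]%N) (f i)%:R * transmit_prob p omega i)%:E.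
Proof.
move=> omega123; rewrite unlock.
pose A i := ((p @^-1` [set true]) `&` (omega @^-1` [set i]))%classic.
have mA i : measurable (A i) := measurable_transmit i.
transitivity (\int[P]_w (\sum_(i <- [:: 1; 2; 3]%N)
    ((f i)%:R%:E * (EFin \o \1_(A i)) w)))%E.
  apply: eq_integral => w _.
  rewrite !big_cons big_nil addr0 -!EFinM -!EFinD; congr EFin.
  have inA i : (w \in A i) = p w && (omega w == i).
    by apply/idP/andP; rewrite inE /A /=; [case=> -> ->|case=> -> /eqP].
  rewrite !indicE !inA; have := omega123 w; rewrite !inE.
  by case: (p w); case/or3P => /eqP -> /=;
    rewrite ?mul1n ?mul0n ?mulr0 ?mulr1 ?addr0 ?add0r.
have mI i : measurable_fun [set: T]%classic (EFin \o (\1_(A i) : T -> R)).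
  exact/measurable_EFinP/measurable_indic.
have I0 i w : [set: T]%classic w -> (0 <= (EFin \o (\1_(A i) : T -> R)) w)%E.
  by rewrite lee_fin indicE.
rewrite ge0_integral_sum // => [|i|i w Tw]; last 2 first.
- exact: measurable_funeM (mI i).
- by rewrite mule_ge0 ?I0 // lee_fin.
rewrite -sumEFin; apply: eq_bigr => i _.
rewrite (ge0_integralZl_EFin P measurableT (I0 i) (mI i)) //=.
by rewrite integral_indic // setIT EFinM fineK //; apply: fin_num_measure (mA i).
Qed.

End transmission.

(** With an empty history and a sure arrival, the conditioning event reduces to [omega 0 = 2], of
    probability [z]; [z != 0] makes the conditional law applicable. *)
Lemma first_slot_transmit_prob (d : measure_display) (T : measurableType d)
    (R : realType) (P : probability T R) (a omega : nat -> {RV P >-> nat})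
    (p : nat -> {RV P >-> bool}) (alg : control_algorithm R) (y z : R) :
  runs_algorithm a omega p alg y z -> z != 0 ->
  transmit_prob P (p 0%N) (omega 0%N) 2 = alg 0%N 2%N 1%N [::] * z.
Proof.
move=> run z0; have := power_law run (t := 0%N) (i := 2%N) (n := 1%N) (h := [::]).
have -> : (omega 0%N @^-1` [set 2%N] `&` a 0%N @^-1` [set 1%N]
    `&` history a omega p 0 @^-1` [set [::]] = omega 0%N @^-1` [set 2%N])%classic.
  apply/seteqP; split=> w; first by case=> [[]].
  by move=> ow; split=> //; split=> //; exact: arrival_one run 0%N w.
rewrite /= (omega_law2 run) => /(_ z0) <-.
by rewrite /condPr (omega_law2 run) divfK.
Qed.

(** Here [alpha + beta] is the height of the line at rate 1. Averaging gives [kappa / t <= avg e -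
    alpha * avg m - beta], and the two approximation bounds make the right side at most
    [(1 + alpha) * eps]. *)
Lemma supporting_line_slack_le (d : measure_display) (T : measurableType d)
    (R : realType) (P : probability T R) (X Y : nat -> T -> R) (e m : nat -> R)
    (alpha beta kappa eps : R) (t : nat) :
  (forall s, 'E_P[X s]%E = (e s)%:E) -> (forall s, 'E_P[Y s]%E = (m s)%:E) ->
  0 <= alpha -> (forall s, alpha * m s + beta <= e s) ->
  alpha * m 0%N + beta + kappa <= e 0%N -> (1 <= t)%N ->
  (time_average P X t <= (alpha + beta + eps)%:E)%E ->
  (1%:E - time_average P Y t <= eps%:E)%E ->
  kappa <= (1 + alpha) * eps * t%:R.
Proof.
move=> EX EY alpha0 line line0 t1.
have avgE (Z : nat -> T -> R) g : (forall s, 'E_P[Z s]%E = (g s)%:E) ->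
    time_average P Z t = (t%:R^-1 * \sum_(0 <= s < t) g s)%:E.
  by move=> EZ; rewrite /time_average (eq_bigr _ (fun s _ => EZ s)) sumEFin.
rewrite (avgE _ _ EX) (avgE _ _ EY) -EFinB !lee_fin.
have t0 : 0 < t%:R :> R by rewrite ltr0n.
have sum_line : alpha * (\sum_(0 <= s < t) m s) + t%:R * beta + kappa <=
    \sum_(0 <= s < t) e s.
  (* Slot 0 is split off because it alone contributes [kappa]. *)
  case: t t1 {avgE t0} => // t _; rewrite !big_nat_recl // mulrDr mulr_sumr.
  have : \sum_(0 <= s < t) (alpha * m s.+1 + beta) <= \sum_(0 <= s < t) e s.+1.
    by apply: ler_sum => s _; apply: line.
  rewrite big_split /= sumr_const_nat subn0 -[beta *+ t]mulr_natl -natr1.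
  by lra.
rewrite ler_pdivrMl // lerBlDr => He.
rewrite -lerBlDl ler_pdivlMl // => Hm.
have := ler_wpM2l alpha0 Hm; lra.
Qed.

Theorem mainTheorem2 (R : realType) :
  exists2 c : R, 0 < c &
  forall (eps : R), 0 < eps -> eps < 64^-1 ->
  forall alg : control_algorithm R,
  exists y z : R, [/\ 0 <= y, 0 <= z, y + z <= 1 &
    forall (d : measure_display) (T : measurableType d) (P : probability T R)
      (a omega : nat -> {RV P >-> nat}) (p : nat -> {RV P >-> bool}),
      runs_algorithm a omega p alg y z ->
      forall t : nat, (1 <= t)%N ->
        (time_average P (power p) t <= (pstar y z + eps)%:E)%E ->
        (1%:E - time_average P (service omega p) t <= eps%:E)%E ->
        c / eps <= t%:R].
Proof.
(* The two cases below give [eps * t >= (1/12) / (4/3) = 1/16] and [eps * t >= (1/4) / 2 = 1/8]. *)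
exists 16^-1 => [|eps eps0 _ alg]; first lra.
pose theta2 := alg 0%N 2%N 1%N [::].
pose y : R := if 2^-1 <= theta2 then 2^-1 else 0.
have y01 : 0 <= y <= 2^-1 by rewrite /y; case: ifP; lra.
exists y, 2^-1; split; [lra|lra|lra|].
move=> d T P a omega p run t t1 Hp Hmu.
pose u s i := transmit_prob P (p s) (omega s) i.
have u0 s i : 0 <= u s i by apply: transmit_prob_ge0.
have Epower s : 'E_P[power p s]%E = (u s 1%N + u s 2%N + u s 3%N)%:E.
  have := expectation_transmit (p s) (fun=> 1%N) (omega_range run s).
  rewrite !big_cons big_nil !mul1r addr0 addrA => <-; congr expectation.
  by apply/funext => w; rewrite muln1.
have Eservice s : 'E_P[service omega p s]%E =
    (u s 1%N + 2 * u s 2%N + 3 * u s 3%N)%:E.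
  have := expectation_transmit (p s) id (omega_range run s).
  by rewrite !big_cons big_nil mul1r addr0 addrA.
have u02 : u 0%N 2%N = theta2 * 2^-1.
  by apply: first_slot_transmit_prob run _; lra.
rewrite ler_pdivrMr // [t%:R * eps]mulrC.
move: Hp run; rewrite /pstar /min_power /y; case: (boolP (2^-1 <= theta2)) => [th|].
  (* Here h(1) = 1/3 and the line is mu / 3. Power exceeds it by [2/3 * u s 1 + 1/3 * u s 2], and
     [u 0 2 >= 1/4] yields the slack 1/12. *)
  have -> : 1 <= 3 * 2^-1 :> R by lra.
  rewrite -[1 / 3]addr0 => Hp run.
  have := supporting_line_slack_le (kappa := 12^-1) Epower Eservice _ _ _ t1 Hp Hmu.
  move=> H; have {H} : 12^-1 <= (1 + 1 / 3) * eps * t%:R.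
    apply: H => [|s|]; first lra.
      by have := u0 s 1%N; have := u0 s 2%N; lra.
    by have := u0 0%N 1%N; lra.
  lra.
rewrite -ltNge => th.
have -> : 1 <= 3 * 0 :> R = false by lra.
have -> : 1 <= 3 * 0 + 2 * 2^-1 :> R by lra.
(* Rate 1 is now a kink of h, where the slopes 1/2 and 1 meet. The line mu - 1/2 of slope 1 is
   chosen: power exceeds it by [1/2 - u s 2 - 2 * u s 3], which penalises idling in state 2;
   [u 0 2 < 1/4] yields the slack 1/4. *)
have -> : 0 + (1 - 3 * 0) / 2 = 1 + - 2^-1 :> R by lra.
move=> Hp run.
have u2 s : u s 2%N <= 2^-1.
  by rewrite -(omega_law2 run s); apply: transmit_prob_le.
have u3 s : u s 3%N <= 0.
  by rewrite -(omega_law3 run s); apply: transmit_prob_le.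
have := supporting_line_slack_le (kappa := 4^-1) Epower Eservice _ _ _ t1 Hp Hmu.
move=> H; have {H} : 4^-1 <= (1 + 1) * eps * t%:R.
  apply: H => [|s|]; first lra.
    by have := u2 s; have := u3 s; lra.
  by have := u3 0%N; lra.
have : 0 <= eps * t%:R by apply: mulr_ge0; [lra|].
lra.
Qed.
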